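(* Let $\lambda \ge 2$ be an integer and let $D$ be a two-way $(2,\lambda)$-liking digraph of order $n$. Then $D$ is $k$-diregular for a positive integer $k$ satisfying \[(n-1)\lambda = k(k-1).\]
   Context: All digraphs are finite, with no loops and no multiple arcs. For positive integers $t$ and $\lambda$, a digraph is a two-way $(t,\lambda)$-liking digraph if every set of $t$ distinct vertices has exactly $\lambda$ common out-neighbors and exactly $\lambda$ common in-neighbors. A digraph is $k$-diregular (for a positive integer $k$) if every vertex has outdegree $k$ and indegree $k$.
   Formalization: The order n is assumed to be at least 2; for n = 0 or 1 the liking condition is vacuous and the claim fails (a single vertex has degree 0, so no positive k exists). *)

(* Defs.v *)
(* A finite digraph without loops or multiple arcs is an
   irreflexive [arc : rel V] on a finite vertex type [V]; opposite arcs
   [arc u v] and [arc v u] may coexist. *)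
From mathcomp Require Import all_boot.
Set Implicit Arguments.
Unset Strict Implicit.
Unset Printing Implicit Defensive.

Section Digraph.
Variables (V : finType) (arc : rel V).

Definition out_neighbors (u : V) : {set V} := [set v | arc u v].
Definition in_neighbors (u : V) : {set V} := [set v | arc v u].

Definition common_out_neighbors (S : {set V}) : {set V} :=
  [set v | [forall u in S, arc u v]].
Definition common_in_neighbors (S : {set V}) : {set V} :=
  [set v | [forall u in S, arc v u]].

Definition two_way_liking (t lambda : nat) : Prop :=
  forall S : {set V}, #|S| = t ->
    #|common_out_neighbors S| = lambda /\ #|common_in_neighbors S| = lambda.

Definition diregular (k : nat) : Prop :=
  forall v : V, #|out_neighbors v| = k /\ #|in_neighbors v| = k.

End Digraph.

(* Main.v *)
(** Write [c v] for the indegree of [v] and [n] for the order.  Counting the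
    walks [j <- u -> w <- v] in two ways gives
    [c j * (n * lambda) + (n - 1) * lambda + c j = c j ^ 2 + lambda * T], where
    [T] is the total indegree.  Hence all indegrees are roots of one quadratic
    polynomial, the sum of whose roots is [n * lambda + 1 > 2 * n].  As no
    indegree exceeds [n], two distinct roots cannot both be indegrees, so the
    indegree is constant.  Reversing the arcs, so is the outdegree. *)
Require Import Defs.
From mathcomp Require Import all_boot zify.
Set Implicit Arguments.
Unset Strict Implicit.
Unset Printing Implicit Defensive.

Definition converse (V : finType) (arc : rel V) : rel V := fun u v => arc v u.

Section TwoWayLiking.
Variables (V : finType) (lambda : nat).
Implicit Type arc : rel V.

Local Notation outdeg arc u := #|out_neighbors arc u|.
Local Notation indeg arc u := #|in_neighbors arc u|.

Lemma two_way_liking_converse arc t :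
  two_way_liking arc t lambda -> two_way_liking (converse arc) t lambda.
Proof. by move=> liking S /liking []. Qed.

Lemma card_out_neighborsI arc u v :
  two_way_liking arc 2 lambda -> u != v ->
  #|out_neighbors arc u :&: out_neighbors arc v| = lambda.
Proof.
move=> liking neq_uv; have [|<- _] := liking [set u; v].
  by rewrite cards2 neq_uv.
apply: eq_card => w; rewrite !inE; apply/andP/forall_inP => [[uw vw] x|all_w].
  by rewrite !inE => /orP[] /eqP->.
by split; apply: all_w; rewrite !inE eqxx ?orbT.
Qed.

(** The term at [v = u] is [f u * outdeg arc u], and every other term is [f v * lambda]; adding
    [lambda * f u] completes the sum of [f] without subtraction. *)
Lemma sum_card_out_neighborsI arc (f : V -> nat) u :
  two_way_liking arc 2 lambda ->
  \sum_v f v * #|out_neighbors arc u :&: out_neighbors arc v| + lambda * f u =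
  f u * outdeg arc u + lambda * \sum_v f v.
Proof.
move=> liking; rewrite (bigD1 u) //= setIid [\sum_v f v](bigD1 u) //=.
rewrite (eq_bigr (fun v => f v * lambda)) => [|v neq_vu].
  by rewrite -big_distrl /=; lia.
by rewrite card_out_neighborsI // eq_sym.
Qed.

(** Both sides count the walks [u -> w <- v] with weight [f v], first by [w], then by [v]. *)
Lemma sum_out_neighbors arc (f : V -> nat) u :
  \sum_(w in out_neighbors arc u) \sum_(v in in_neighbors arc w) f v =
  \sum_v f v * #|out_neighbors arc u :&: out_neighbors arc v|.
Proof.
rewrite (exchange_big_dep xpredT) //=; apply: eq_bigr => v _.
rewrite (eq_bigl [in out_neighbors arc u :&: out_neighbors arc v]) => [|w].
  by rewrite sum_nat_const mulnC.
by rewrite !inE.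
Qed.

Lemma sum_indeg_out_neighbors arc u :
  two_way_liking arc 2 lambda ->
  \sum_(w in out_neighbors arc u) indeg arc w + lambda =
  outdeg arc u + lambda * #|V|.
Proof.
move=> /(sum_card_out_neighborsI (fun=> 1) u).
rewrite -sum_out_neighbors sum1_card muln1 mul1n => <-.
by congr (_ + _); apply: eq_bigr => w _; rewrite sum1_card.
Qed.

Lemma indeg_quadratic arc j :
  two_way_liking arc 2 lambda ->
  let c := indeg arc j in
  c * (lambda * #|V|) + lambda * #|V| + c =
  c * c + lambda * \sum_v indeg arc v + lambda.
Proof.
move=> liking c; have likingC := two_way_liking_converse liking.
(* First count: the weight [indeg arc v] stands for the last arc of the walk, into [v]. *)
have := sum_card_out_neighborsI (fun v => indeg arc v) j likingC.
rewrite -sum_out_neighbors -[outdeg _ j]/c.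
have sum_r := sum_indeg_out_neighbors j likingC.
(* Second count: the inner sums reduce to outdegrees, whose sum over the in-neighbors of [j] is
   given by [sum_r]. *)
have : \sum_(w in out_neighbors (converse arc) j)
    (\sum_(v in in_neighbors (converse arc) w) indeg arc v + lambda) =
  \sum_(w in out_neighbors (converse arc) j)
    (indeg (converse arc) w + lambda * #|V|).
  by apply: eq_bigr => w _; apply: sum_indeg_out_neighbors.
rewrite !big_split /= !sum_nat_const.
move: sum_r; rewrite -[outdeg _ j]/c; move: c => c.
set A := \sum_(i in _) \sum_(v in _) _; set B := \sum_(w in _) _.
move: A B (\sum_v _) #|V| => A B T n; lia.
Qed.

Lemma indeg_constant arc u v :
  1 < lambda -> two_way_liking arc 2 lambda -> indeg arc u = indeg arc v.
Proof.
move=> lambda_gt1 liking.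
have := indeg_quadratic u liking; have := indeg_quadratic v liking => /=.
have := max_card (in_neighbors arc u); have := max_card (in_neighbors arc v).
set x := #|in_neighbors arc u|; set y := #|in_neighbors arc v|.
set T := \sum_v _; move=> y_le x_le eq_y eq_x.
have : 2 * #|V| <= lambda * #|V| by rewrite leq_mul2r lambda_gt1 orbT.
move: (lambda * #|V|) eq_y eq_x => N eq_y eq_x N_ge.
(* If [x] and [y] differ, subtracting the equations and cancelling [x - y] leaves [x + y = N + 1],
   yet [x + y <= 2 * #|V| <= N]. *)
by case: (ltngtP x y) => //; nia.
Qed.

End TwoWayLiking.

Theorem theorem1p1 (lambda n : nat) (V : finType) (arc : rel V)
    (lambda_ge2 : 2 <= lambda)
    (loopless : irreflexive arc)
    (order_n : #|V| = n)
    (n_ge2 : 2 <= n)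
    (liking : two_way_liking arc 2 lambda) :
  exists k : nat,
    [/\ 0 < k, diregular arc k & (n - 1) * lambda = k * (k - 1)].
Proof.
have likingC := two_way_liking_converse liking.
have /card_gt1P[a [b [_ _ neq_ab]]] : 1 < #|V| by rewrite order_n.
set k := #|in_neighbors arc a|; set r := #|in_neighbors (converse arc) a|.
have indegE v : #|in_neighbors arc v| = k by apply: indeg_constant liking.
have outdegE v : #|out_neighbors arc v| = r.
  exact: (@indeg_constant _ _ (converse arc) v a lambda_ge2 likingC).
(* This makes the common degree positive. *)
have r_ge : lambda <= r.
  rewrite -(card_out_neighborsI liking neq_ab) -(outdegE a).
  by rewrite subset_leq_card ?subsetIl.
have := sum_indeg_out_neighbors a liking.
have := sum_indeg_out_neighbors a likingC.
rewrite (eq_bigr (fun=> r)) => [|w _]; last exact: outdegE.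
rewrite [in X in _ -> X](eq_bigr (fun=> k)) => [|w _]; last exact: indegE.
rewrite !sum_nat_const outdegE -[#|out_neighbors _ a|]/k order_n => eq_k eq_r.
(* Both equations have left side [r * k + lambda], up to commutation; their right sides differ only
   in [r] against [k]. *)
have eq_rk : r = k by lia.
exists k; split=> [|v|]; first by lia.
  by rewrite outdegE indegE eq_rk.
by move: eq_r; rewrite eq_rk; nia.
Qed.
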